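(* Let $W:\mathcal{X}\to\mathcal{S}(B)$ be a cq-channel, $n\ge1$, and $0<\delta\le\sqrt{n}\log|B|$. Let $u_1,\ldots,u_N\in\mathcal{X}^n$ be codewords such that $1-\frac12\|W_{u_j}-W_{u_k}\|_1\le 2^{-3\delta\sqrt{n}}$ for all $j\neq k$. Then there exists a subset $\mathcal{C}\subset[N]$ with $|\mathcal{C}|\ge N/\lceil n\log|B|\rceil$ such that $\{(u_j,E_j=\Pi^\delta_{u_j}):j\in\mathcal{C}\}$ is an $(n,|\mathcal{C}|,\lambda_1,\lambda_2)$-DI code with $\lambda_1=\eta$ and $\lambda_2=\eta+6\exp(-\delta\sqrt{n})$, where $\eta=2\exp\!\left(-\delta^2/36K(|B|)\right)$.
   Context: A cq-channel is a measurable map $W:\mathcal{X}\to\mathcal{S}(B)$, $x\mapsto W_x$, from a measure space $\mathcal{X}$ to the density operators on a finite-dimensional Hilbert space $B$ (dimension $|B|$). For $x^n=x_1\ldots x_n$, $W_{x^n}=W_{x_1}\otimes\cdots\otimes W_{x_n}$. $\log$ and $\exp$ are to base 2; $K(d)=(\log\max\{d,3\})^2$; $S(\cdot)$ is the von Neumann entropy. The entropy typical projector $\Pi^\delta_{x^n}$ is the projector onto the span of all eigenspaces of $-\log W_{x^n}$ with eigenvalues in $[S(W_{x^n})-\delta\sqrt{n},\,S(W_{x^n})+\delta\sqrt{n}]$. An $(n,N,\lambda_1,\lambda_2)$-DI code for $W$ is a collection $\{(u_j,E_j):j\in[N]\}$ with $u_j\in\mathcal{X}^n$ and operators $0\le E_j\le\mathbb{1}$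 on $B^{\otimes n}$ such that for all $j\neq k$: $\operatorname{Tr}W_{u_j}E_j\ge1-\lambda_1$ and $\operatorname{Tr}W_{u_j}E_k\le\lambda_2$. *)

(* Defs.v *)
From HB Require Import structures.
From mathcomp Require Import all_boot all_order all_algebra.
From mathcomp Require Import sesquilinear spectral.
From mathcomp Require Import complex.
From mathcomp Require Import reals sequences exp.

Set Implicit Arguments.
Unset Strict Implicit.
Unset Printing Implicit Defensive.

Import Order.TTheory GRing.Theory Num.Theory.
Local Open Scope ring_scope.

Definition log2 {R : realType} (x : R) : R := ln x / ln 2.
Definition exp2 {R : realType} (x : R) : R := expR (x * ln 2).

Definition Kfun {R : realType} (d : nat) : R := (log2 (maxn d 3)%:R) ^+ 2.

Definition reC {R : realType} (z : R[i]) : R := complex.Re z.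

Definition adj {R : realType} {m n : nat} (A : 'M[R[i]]_(m, n)) : 'M[R[i]]_(n, m) :=
  map_mx Num.conj (A ^T).

(** eigenvalues (with multiplicity) of a normal matrix, via MathComp's spectral
    decomposition A = P^-1 diag(spectral_diag A) P, P unitary *)
Definition eigval {R : realType} {m : nat} (A : 'M[R[i]]_m) (i : 'I_m) : R[i] :=
  spectral_diag A 0 i.

Definition mxcalc {R : realType} {m : nat} (f : R -> R) (A : 'M[R[i]]_m) : 'M[R[i]]_m :=
  invmx (spectralmx A) *m diag_mx (\row_i ((f (reC (eigval A i)))%:C)%C) *m spectralmx A.

Definition psd {R : realType} {m : nat} (A : 'M[R[i]]_m) : Prop :=
  A \is hermsymmx /\ forall v : 'rV[R[i]]_m, 0 <= (v *m A *m adj v) 0 0.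
Definition loewner_le {R : realType} {m : nat} (A B : 'M[R[i]]_m) : Prop := psd (B - A).
Definition density {R : realType} {m : nat} (A : 'M[R[i]]_m) : Prop :=
  psd A /\ \tr A = 1.

Definition xlogx {R : realType} (x : R) : R := if 0 < x then x * log2 x else 0.
Definition entropy {R : realType} {m : nat} (A : 'M[R[i]]_m) : R :=
  - \sum_i xlogx (reC (eigval A i)).

Definition trnorm {R : realType} {m : nat} (A : 'M[R[i]]_m) : R :=
  \sum_i Num.sqrt (reC (eigval (adj A *m A) i)).

(** n-fold tensor power space B^{(x) n}, with |B| = d: basis indexed by
    the functions 'I_n -> 'I_d (product basis). *)
Definition tdim (n d : nat) : nat := #|{ffun 'I_n -> 'I_d}|.

Definition tensW {R : realType} {X : Type} {d : nat} (W : X -> 'M[R[i]]_d)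
  (n : nat) (x : 'I_n -> X) : 'M[R[i]]_(tdim n d) :=
  \matrix_(i, j) \prod_(k < n)
     W (x k) (@enum_val _ (mem {: {ffun 'I_n -> 'I_d}}) i k)
             (@enum_val _ (mem {: {ffun 'I_n -> 'I_d}}) j k).

(** entropy typical projector Pi^delta_{x^n}: projector onto the span of the
    eigenspaces of -log W_{x^n} with eigenvalues in
    [S(W_{x^n}) - delta sqrt n, S(W_{x^n}) + delta sqrt n]
    (eigenvalue 0 of W corresponds to -log 0 = +oo, never in the window). *)
Definition typproj {R : realType} {X : Type} {d : nat} (W : X -> 'M[R[i]]_d)
  (n : nat) (delta : R) (x : 'I_n -> X) : 'M[R[i]]_(tdim n d) :=
  let A := tensW W x in
  let S := entropy A in
  mxcalc (fun l : R => if (0 < l) &&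
              (S - delta * Num.sqrt n%:R <= - log2 l <= S + delta * Num.sqrt n%:R)
           then 1 else 0) A.

Definition DI_code {R : realType} {X : Type} {d : nat} (W : X -> 'M[R[i]]_d)
  (n N : nat) (Cset : {set 'I_N}) (u : 'I_N -> 'I_n -> X)
  (E : 'I_N -> 'M[R[i]]_(tdim n d)) (lambda1 lambda2 : R) : Prop :=
  (forall j, j \in Cset -> loewner_le 0 (E j) /\ loewner_le (E j) 1%:M) /\
  (forall j, j \in Cset -> ((1 - lambda1)%:C)%C <= \tr (tensW W (u j) *m E j)) /\
  (forall j k, j \in Cset -> k \in Cset -> j != k ->
      \tr (tensW W (u j) *m E k) <= (lambda2%:C)%C).

(* Main.v *)
Require Import Defs.
From HB Require Import structures.
From mathcomp Require Import all_boot all_order all_algebra.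
From mathcomp Require Import sesquilinear spectral.
From mathcomp Require Import complex.
From mathcomp Require Import reals sequences exp.
From mathcomp Require Import topology normedtype derive.
From mathcomp Require Import ring lra.

(** For j <> k the hypothesis gives a projector P (the positive part of
    W_{u_j} - W_{u_k}) with Tr W_{u_j} (1 - P) <= eps and Tr W_{u_k} P <= eps,
    where eps = 2^(-3 delta sqrt n). Discarding the atypical part of W_{u_j}
    costs eta; the typical part A satisfies the pinching inequality
    A <= 2 P A P + 2 (1 - P) A (1 - P). The second term contributes at most
    2 eps, and the first at most
      2 * 2^(-S(W_{u_j}) + delta sqrt n) * 2^(S(W_{u_k}) + delta sqrt n) * eps,
    because A <= 2^(-S(W_{u_j}) + delta sqrt n) and
    Pi_{u_k} <= 2^(S(W_{u_k}) + delta sqrt n) W_{u_k}. The entropies lie in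
    [0, n log d], so a pigeonhole argument over unit bins makes the factor
    2^(S(W_{u_k}) - S(W_{u_j})) at most 2. The typicality estimate is a
    Chernoff bound for the sum of the independent variables - log p_k, p_k being
    the spectrum of W_{x_k}. *)

Set Implicit Arguments.
Unset Strict Implicit.
Unset Printing Implicit Defensive.

Import Order.TTheory GRing.Theory Num.Theory.
Import numFieldNormedType.Exports.
Local Open Scope ring_scope.

(** * Concentration of the information content *)

Lemma ge0_of_derive (R : realType) (f f' : R -> R) (x : R) :
    (forall y : R, is_derive y (1 : R) f (f' y)) -> f 0 = 0 ->
    (forall y, 0 <= y -> 0 <= f' y) -> 0 <= x -> 0 <= f x.
Proof.
move=> df f0 f'0 x0.
have [] := @MVT_segment R f f' 0 x x0 (fun y _ => df y).
  by apply: derivable_within_continuous => y _; case: (df y).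
move=> c /andP[/= c0 _]; rewrite f0 !subr0 => ->.
by rewrite mulr_ge0 // f'0.
Qed.

(** A second-order Taylor bound for both signs of [x]; for a centred variable its linear term
    averages to zero. For negative [x] the bound already holds without the exponential factor. *)
Lemma expR_le_quad (R : realType) (x : R) :
  expR x <= 1 + x + x ^+ 2 / 2 * expR `|x|.
Proof.
have [x0|x0] := leP 0 x.
  rewrite ger0_norm // -subr_ge0.
  pose f y : R := 1 + y + y ^+ 2 / 2 * expR y - expR y.
  pose f' y : R := 1 - (1 - y) * expR y + y ^+ 2 / 2 * expR y.
  apply: (@ge0_of_derive R f f') => // [y||y y0].
  - rewrite /f /f'; apply: is_derive_eq.
    by rewrite /GRing.scale /=; field.
  - by rewrite /f /= expR0; field.
  - rewrite /f' addr_ge0 ?mulr_ge0 ?invr_ge0 ?expR_ge0 ?sqr_ge0 //.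
    rewrite subr_ge0 -[leRHS](expRxMexpNx_1 y) mulrC ler_wpM2l ?expR_ge0 //.
    exact: expR_ge1Dx.
rewrite ltr0_norm //.
have [y y0 ->] : exists2 y : R, 0 <= y & x = - y by exists (- x); lra.
have : expR (- y) <= 1 - y + y ^+ 2 / 2.
  rewrite -subr_ge0.
  pose f z : R := 1 - z + z ^+ 2 / 2 - expR (- z).
  pose f' z : R := - 1 + z + expR (- z).
  apply: (@ge0_of_derive R f f') => // [z||z z0].
  - rewrite /f /f'; apply: is_derive_eq.
    by rewrite /GRing.scale /=; field.
  - by rewrite /f /= oppr0 expR0; field.
  - by have := expR_ge1Dx (- z); rewrite /f'; lra.
have : 1 <= expR y by rewrite -expR0 ler_expR.
by rewrite opprK sqrrN; have := sqr_ge0 y; nra.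
Qed.

(** With [w = c * z / 2] this reads [(w * expR (- w)) ^+ 2 <= 1], which follows from
    [w <= 1 + w <= expR w]. *)
Lemma mul_expRN_le1 (R : realType) (c z : R) : 0 < c -> 0 <= z ->
  expR (- (c * z)) * z ^+ 2 <= 4 / c ^+ 2.
Proof.
move=> c0 z0; rewrite ler_pdivlMr ?exprn_gt0 //.
have h : c * z / 2 <= expR (c * z / 2) by have := expR_ge1Dx (c * z / 2); lra.
have h0 : 0 <= c * z / 2 by rewrite divr_ge0 // mulr_ge0 // ltW.
have -> : expR (- (c * z)) * z ^+ 2 * c ^+ 2
   = 4 * (expR (- (c * z / 2)) * (c * z / 2)) ^+ 2.
  rewrite exprMn -expRM_natl; have -> : 2 * - (c * z / 2) = - (c * z) by field.
  by field.
rewrite -[leRHS]mulr1 ler_pM2l // expr_le1 //; last first.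
  by apply: mulr_ge0 => //; exact: expR_ge0.
by rewrite expRN mulrC ler_pdivrMr ?expR_gt0 // mul1r.
Qed.

(** For [y = - ln q] the left side is [q] to the power [1 - t]. Up to [L] the factor [expR (t * y)]
    is at most [expR (t * L)]; beyond [L] the whole product decreases in [y], so its value at [L]
    bounds it. *)
Lemma expRN_mul_split (R : realType) (L t y : R) : 0 <= t ->  t < 1 -> 0 <= y ->
  expR (- y) * expR (t * y) <= expR (t * L) * (expR (- y) + expR (- L)).
Proof.
move=> t0 t1 y0; rewrite mulrDr -!expRD; have [yL|Ly] := leP y L.
  rewrite ler_wpDr ?expR_ge0 // ler_expR [leRHS]addrC lerD2l.
  by rewrite ler_wpM2l.
rewrite ler_wpDl ?expR_ge0 // ler_expR.
have : 0 <= (1 - t) * (y - L) by rewrite mulr_ge0 ?subr_ge0 // ltW.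
by lra.
Qed.

(** The same split with a quadratic weight. Beyond [L], writing [y = L + z] gives
    [y ^+ 2 <= 2 * L ^+ 2 + 2 * z ^+ 2], and the decay [expR (- ((1 - t) * z))] absorbs [z ^+ 2] at
    the cost [8 / (1 - t) ^+ 2]. *)
Lemma expRN_mul_sqr_split (R : realType) (L t y : R) :
    0 <= t -> t < 1 -> 0 <= y ->
  expR (- y) * expR (t * y) * y ^+ 2 <= expR (t * L) *
    (2 * L ^+ 2 * (expR (- y) + expR (- L)) + 8 / (1 - t) ^+ 2 * expR (- L)).
Proof.
move=> t0 t1 y0.
have K0 : 0 <= 8 / (1 - t) ^+ 2 by rewrite divr_ge0 ?sqr_ge0.
have e0 (z : R) : 0 <= expR z by exact: expR_ge0.
have [yL|Ly] := leP y L.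
  have y2 : y ^+ 2 <= L ^+ 2 by rewrite lerXn2r ?nnegrE // (le_trans y0).
  have := expRN_mul_split L t0 t1 y0.
  have a0 : 0 <= expR (t * L) * (8 / (1 - t) ^+ 2 * expR (- L)).
    by rewrite mulr_ge0 // mulr_ge0.
  have b0 : 0 <= expR (t * L) * (expR (- y) + expR (- L)).
    by rewrite mulr_ge0 ?addr_ge0.
  move=> h; have : expR (- y) * expR (t * y) * y ^+ 2
      <= expR (t * L) * (expR (- y) + expR (- L)) * L ^+ 2.
    exact: (ler_pM (mulr_ge0 (e0 _) (e0 _)) (sqr_ge0 y) h y2).
  have := mulr_ge0 b0 (sqr_ge0 L).
  by lra.
pose z := y - L; have z0 : 0 <= z by rewrite subr_ge0 ltW.
have t10 : 0 < 1 - t by rewrite subr_gt0.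
have -> : expR (- y) * expR (t * y)
    = expR (t * L) * expR (- L) * expR (- ((1 - t) * z)).
  by rewrite -!expRD; congr expR; rewrite /z; ring.
have h1 := mul_expRN_le1 t10 z0.
have h2 : expR (- ((1 - t) * z)) <= 1.
  by rewrite expR_le1 oppr_le0 mulr_ge0 // ltW.
have h3 : y ^+ 2 <= 2 * L ^+ 2 + 2 * z ^+ 2.
  have -> : y = z + L by rewrite /z subrK.
  by have := sqr_ge0 (z - L); lra.
rewrite -!mulrA ler_wpM2l //.
have h4 : expR (- ((1 - t) * z)) * y ^+ 2 <= 2 * L ^+ 2 + 8 / (1 - t) ^+ 2.
  apply: (le_trans (ler_wpM2l (e0 _) h3)).
  have := ler_wpM2r (sqr_ge0 L) h2.
  by move: h1; lra.
apply: (le_trans (ler_wpM2l (e0 _) h4)).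
have := mulr_ge0 (sqr_ge0 L) (e0 (- y)).
by lra.
Qed.

Lemma card_gt0_of_sum1 (R : realType) (T : finType) (p : T -> R) :
  \sum_x p x = 1 -> (0 < #|T|)%N.
Proof.
move=> p1; rewrite lt0n; apply/eqP => T0.
move: p1; rewrite big1 => [/eqP|x _]; first by rewrite (eq_sym 0) oner_eq0.
by have := card0_eq T0 x.
Qed.

(** Gibbs' inequality against the uniform law: use [ln z <= z - 1] at [z = 1 / (p x * #|T|)],
    weighted by [p x]; the resulting bounds [1 / #|T| - p x] sum to zero. *)
Lemma gibbs_ln_card (R : realType) (T : finType) (p : T -> R) :
    (forall x, 0 <= p x) -> \sum_x p x = 1 ->
  \sum_x p x * - ln (p x) <= ln #|T|%:R.
Proof.
move=> p0 p1; have T0 : 0 < #|T|%:R :> R.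
  by have := ltr0n R #|T|; rewrite (card_gt0_of_sum1 p1).
rewrite -subr_le0 -[X in _ - X]mul1r -[X in _ - X * _]p1 mulr_suml -sumrB.
apply: (@le_trans _ _ (\sum_x (#|T|%:R^-1 - p x))); last first.
  rewrite sumrB p1 sumr_const.
  by rewrite -[X in X - _]mulr_natl mulfV ?subrr // gt_eqF.
apply: ler_sum => x _; rewrite -mulrBr; have := p0 x.
rewrite le_eqVlt => /predU1P[<-|px]; first by rewrite mul0r subr0 invr_ge0 ltW.
have pT : 0 < p x * #|T|%:R by rewrite mulr_gt0.
have -> : - ln (p x) - ln #|T|%:R = ln ((p x * #|T|%:R)^-1).
  by rewrite lnV ?posrE // lnM ?posrE // opprD.
have h : ln ((p x * #|T|%:R)^-1) <= (p x * #|T|%:R)^-1 - 1.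
  have pT' : 0 < (p x * #|T|%:R)^-1 by rewrite invr_gt0.
  by have := expR_ge1Dx (ln (p x * #|T|%:R)^-1); rewrite lnK ?posrE //; lra.
apply: (le_trans (ler_wpM2l (ltW px) h)).
by rewrite mulrBr mulr1 invfM mulrA mulfV ?gt_eqF // mul1r.
Qed.

Lemma le1_of_sum1 (R : realType) (T : finType) (p : T -> R) (x : T) :
  (forall x, 0 <= p x) -> \sum_x p x = 1 -> p x <= 1.
Proof. by move=> p0 <-; rewrite (bigD1 x) //= lerDl sumr_ge0. Qed.

(* The moment [sum p |ln p|^2 p^(-t)] is bounded by splitting at p = e^(-L): above
   it [|ln p| <= L], and the at most e^L smaller weights contribute O(1) each
   after rescaling by e^L. *)
Lemma mgf_information (R : realType) (T : finType) (p : T -> R) (L t : R) :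
    (forall x, 0 <= p x) -> \sum_x p x = 1 ->
    1 <= L -> #|T|%:R <= expR L -> `|t| * L <= 18^-1 ->
  \sum_x p x * expR (t * (- ln (p x) - \sum_y p y * - ln (p y)))
    <= expR (9 * L ^+ 2 * t ^+ 2).
Proof.
move=> p0 p1 L1 TL tL.
set H := \sum_y p y * - ln (p y).
have ple1 x : p x <= 1 by exact: le1_of_sum1.
have lnp x : 0 <= - ln (p x) by rewrite oppr_ge0 ln_le0.
have H0 : 0 <= H by apply: sumr_ge0 => x _; rewrite mulr_ge0.
have T0 : 0 < #|T|%:R :> R.
  by have := ltr0n R #|T|; rewrite (card_gt0_of_sum1 p1).
have HL : H <= L.
  apply: (le_trans (gibbs_ln_card p0 p1)).
  by rewrite -[L]expRK ler_ln ?posrE ?expR_gt0.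
set s := `|t| in tL *; have s0 : 0 <= s by exact: normr_ge0.
have s18 : s <= 18^-1 by apply: le_trans tL; rewrite ler_peMr.
have s1 : s < 1 by lra.
pose K : R := 8 / (1 - s) ^+ 2.
have K9 : K <= 9.
  rewrite /K ler_pdivrMr ?exprn_gt0 //; last by rewrite subr_gt0.
  have : (17 / 18) ^+ 2 <= (1 - s) ^+ 2.
    by rewrite lerXn2r ?nnegrE; lra.
  by lra.
have K0 : 0 <= K by rewrite /K divr_ge0 ?sqr_ge0.
pose e := expR (s * L); have e0 : 0 <= e by exact: expR_ge0.
(* Since [2 * s * L <= 1/9], the inverse of [e * e] is at least [1 - 1/9]. One factor [e] comes from
   centring by [H <= L], the other from the split at [L]. *)
have e2 : e * e <= 9 / 8.
  rewrite /e -expRD; have : expR (- (s * L + s * L)) >= 8 / 9.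
    by have := expR_ge1Dx (- (s * L + s * L)); lra.
  rewrite expRN => h; have p98 : 0 < 9 / 8 :> R by lra.
  rewrite -[leLHS]invrK -[leRHS]invrK lef_pV2 ?posrE ?invr_gt0 ?expR_gt0 //.
  by rewrite invfM invrK mulrC.
(* The linear term will sum to zero because [H] is the mean. The square is at most [y ^+ 2 + L ^+ 2]
   for [y = - ln (p x)]; the split bounds charge [2 * L ^+ 2] for the first summand and [L ^+ 2] for
   the second, whence the 3. *)
have key x : p x * expR (t * (- ln (p x) - H)) <=
   p x + t * (p x * - ln (p x) - p x * H)
   + t ^+ 2 / 2 * (e * e) * (3 * L ^+ 2 * (p x + expR (- L)) + K * expR (- L)).
  have := p0 x; rewrite le_eqVlt => /predU1P[<-|px].
    rewrite !mul0r subr0 mulr0 !add0r -mulrDl.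
    have c0 : 0 <= t ^+ 2 / 2 * (e * e).
      by apply: mulr_ge0; [rewrite divr_ge0 ?sqr_ge0 | exact: mulr_ge0].
    apply: mulr_ge0 => //; apply: mulr_ge0; last exact: expR_ge0.
    by have := sqr_ge0 L; lra.
  set y := - ln (p x); have y0 : 0 <= y by exact: lnp.
  have pE : p x = expR (- y) by rewrite /y opprK lnK.
  have q1 := expR_le_quad (t * (y - H)).
  have q2 : expR `|t * (y - H)| <= e * expR (s * y).
    rewrite /e -expRD ler_expR normrM -/s -mulrDr ler_wpM2l //.
    by rewrite (le_trans (ler_normB _ _)) // !ger0_norm // addrC lerD2r.
  have q3 : (t * (y - H)) ^+ 2 <= t ^+ 2 * (y ^+ 2 + L ^+ 2).
    rewrite exprMn ler_wpM2l ?sqr_ge0 //.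
    have h2 : H ^+ 2 <= L ^+ 2 by rewrite lerXn2r ?nnegrE // (le_trans H0).
    have : 0 <= y * H by rewrite mulr_ge0.
    by rewrite sqrrB; lra.
  have q4 : (t * (y - H)) ^+ 2 / 2 * expR `|t * (y - H)|
      <= t ^+ 2 * (y ^+ 2 + L ^+ 2) / 2 * (e * expR (s * y)).
    apply: ler_pM => //; rewrite ?expR_ge0 ?divr_ge0 ?sqr_ge0 //.
    by rewrite ler_wpM2r // invr_ge0.
  have q5 := expRN_mul_split L s0 s1 y0.
  have q6 := expRN_mul_sqr_split L s0 s1 y0.
  rewrite -/e -/K -pE in q5 q6.
  have q7 : p x * (t ^+ 2 * (y ^+ 2 + L ^+ 2) / 2 * (e * expR (s * y))) <=
      t ^+ 2 / 2 * (e * e) * (3 * L ^+ 2 * (p x + expR (- L)) + K * expR (- L)).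
    have c0 : 0 <= t ^+ 2 / 2 * e by rewrite mulr_ge0 // divr_ge0 // sqr_ge0.
    have := ler_wpM2l c0 q6.
    have := ler_wpM2l c0 (ler_wpM2l (sqr_ge0 L) q5).
    by lra.
  have := ler_wpM2l (ltW px) q1; have := ler_wpM2l (ltW px) q4.
  by move: q7; lra.
apply: le_trans; first by apply: ler_sum => x _; exact: key.
have d1 : \sum_(x : T) expR (- L) <= 1.
  rewrite sumr_const -[leLHS]mulr_natl expRN ler_pdivrMr ?expR_gt0 //.
  by rewrite mul1r.
have L2 : 1 <= L ^+ 2 by rewrite exprn_ege1.
rewrite !big_split /= -!mulr_sumr sumrB -mulr_suml p1 mul1r subrr mulr0 addr0.
rewrite big_split /= -!mulr_sumr big_split /= p1.
set D := \sum_(_ : T) _ in d1 *.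
have D0 : 0 <= D by apply: sumr_ge0 => x _; exact: expR_ge0.
apply: le_trans (expR_ge1Dx _); rewrite lerD2l.
(* From [D <= 1], [K <= 9] and [1 <= L]. The final coefficient is then [1/2 * 9/8 * 15 = 135/16],
   below 9. *)
have b1 : 3 * L ^+ 2 * (1 + D) + K * D <= 15 * L ^+ 2.
  have := ler_wpM2l (sqr_ge0 L) d1; have : K * D <= 9 * 1 by rewrite ler_pM.
  by lra.
have b0 : 0 <= 3 * L ^+ 2 * (1 + D) + K * D.
  have := mulr_ge0 (sqr_ge0 L) D0; have := mulr_ge0 K0 D0.
  by have := sqr_ge0 L; lra.
have b2 := ler_pM (mulr_ge0 e0 e0) b0 e2 b1.
have c0 : 0 <= t ^+ 2 / 2 by rewrite divr_ge0 // sqr_ge0.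
have := ler_wpM2l c0 b2.
by have := mulr_ge0 c0 (sqr_ge0 L); lra.
Qed.

(** Markov's inequality for [expR (t * Y x)]. *)
Lemma chernoff_one_sided (R : realType) (T : finType) (P Y : T -> R) (t a c : R) :
    (forall x, 0 <= P x) -> 0 <= t ->
    \sum_x P x * expR (t * Y x) <= expR c ->
  \sum_(x | a <= Y x) P x <= expR (c - t * a).
Proof.
move=> P0 t0 h; rewrite expRD expRN ler_pdivlMr ?expR_gt0 //.
apply: le_trans h; rewrite mulr_suml.
apply: (@le_trans _ _ (\sum_(x | a <= Y x) P x * expR (t * Y x))).
  by apply: ler_sum => x ax; rewrite ler_wpM2l // ler_expR ler_wpM2l.
rewrite [leRHS](bigID (fun x => a <= Y x)) /= lerDl.
by apply: sumr_ge0 => x _; rewrite mulr_ge0 ?expR_ge0.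
Qed.

(** By independence the sum over words factors into one moment generating function per position. *)
Lemma mgf_information_prod (R : realType) (I T : finType) (p : I -> T -> R)
    (L t : R) :
    (forall k x, 0 <= p k x) -> (forall k, \sum_x p k x = 1) ->
    1 <= L -> #|T|%:R <= expR L -> `|t| * L <= 18^-1 ->
  \sum_(g : {ffun I -> T}) (\prod_k p k (g k)) *
      expR (t * \sum_k (- ln (p k (g k)) - \sum_y p k y * - ln (p k y)))
    <= expR (9 * L ^+ 2 * t ^+ 2 * #|I|%:R).
Proof.
move=> p0 p1 L1 TL tL.
pose F k x := p k x * expR (t * (- ln (p k x) - \sum_y p k y * - ln (p k y))).
have -> : \sum_(g : {ffun I -> T}) (\prod_k p k (g k)) *
      expR (t * \sum_k (- ln (p k (g k)) - \sum_y p k y * - ln (p k y)))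
    = \sum_(g : {ffun I -> T}) \prod_k F k (g k).
  by apply: eq_bigr => g _; rewrite mulr_sumr expR_sum -big_split.
rewrite -(bigA_distr_bigA F) expRM_natr -prodr_const.
apply: ler_prod => k _; apply/andP; split; last exact: mgf_information.
by apply: sumr_ge0 => x _; rewrite mulr_ge0 ?expR_ge0.
Qed.

(** A Chernoff bound for each tail, at [t] and at [- t]; adding the two gives the factor 2. *)
Lemma information_concentration (R : realType) (I T : finType)
    (p : I -> T -> R) (L a : R) :
    (forall k x, 0 <= p k x) -> (forall k, \sum_x p k x = 1) ->
    1 <= L -> #|T|%:R <= expR L -> (0 < #|I|)%N ->
    0 <= a -> a <= #|I|%:R * L ->
  \sum_(g : {ffun I -> T} |
      a <= `|\sum_k (- ln (p k (g k)) - \sum_y p k y * - ln (p k y))|)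
    \prod_k p k (g k) <= 2 * expR (- (a ^+ 2 / (36 * L ^+ 2 * #|I|%:R))).
Proof.
move=> p0 p1 L1 TL I0 a0 aL.
have n0 : 0 < #|I|%:R :> R by rewrite ltr0n.
have L0 : 0 < L by lra.
set Y := fun g : {ffun I -> T} =>
  \sum_k (- ln (p k (g k)) - \sum_y p k y * - ln (p k y)).
set P := fun g : {ffun I -> T} => \prod_k p k (g k).
have P0 g : 0 <= P g by apply: prodr_ge0.
(* The minimiser of [9 L^2 t^2 n - t a]. *)
pose t := a / (18 * L ^+ 2 * #|I|%:R).
have L2n0 : 0 < L ^+ 2 * #|I|%:R by rewrite mulr_gt0 ?exprn_gt0.
have t0 : 0 <= t by rewrite /t divr_ge0 // -mulrA mulr_ge0 // ltW.
(* Here [t * L = a / (18 * L * #|I|)], so [a <= #|I| * L] is exactly the admissible range of the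
   moment bound. *)
have tL : `|t| * L <= 18^-1.
  rewrite ger0_norm // /t mulrAC ler_pdivrMr; last by rewrite -mulrA mulr_gt0.
  have -> : 18^-1 * (18 * L ^+ 2 * #|I|%:R) = #|I|%:R * L * L by field.
  by rewrite ler_wpM2r // ltW.
have expE : 9 * L ^+ 2 * t ^+ 2 * #|I|%:R - t * a
    = - (a ^+ 2 / (36 * L ^+ 2 * #|I|%:R)).
  by rewrite /t; field; rewrite !gt_eqF.
have up : \sum_(g | a <= Y g) P g <= expR (- (a ^+ 2 / (36 * L ^+ 2 * #|I|%:R))).
  rewrite -expE; apply: chernoff_one_sided => //.
  exact: mgf_information_prod.
have dn : \sum_(g | a <= - Y g) P g <= expR (- (a ^+ 2 / (36 * L ^+ 2 * #|I|%:R))).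
  rewrite -expE; apply: chernoff_one_sided => //.
  have := @mgf_information_prod R I T p L (- t) p0 p1 L1 TL.
  rewrite normrN sqrrN => /(_ tL); apply: le_trans.
  by apply: ler_sum => g _; rewrite mulrN mulNr.
apply: le_trans (_ : \sum_(g | a <= Y g) P g + \sum_(g | a <= - Y g) P g <= _); last first.
  by have := lerD up dn; lra.
rewrite !(big_mkcond (fun g => a <= _)) -big_split /=.
apply: ler_sum => g _; rewrite ler_normr.
by case: (a <= Y g); case: (a <= - Y g); rewrite //= ?addr0 ?add0r ?lerDl.
Qed.

(** All coordinates but [k] sum out to 1. This yields the additivity of entropy over tensor
    factors. *)
Lemma sum_prod_marginal (R : comNzRingType) (I T : finType) (p : I -> T -> R)
    (k : I) (f : T -> R) :
    (forall k, \sum_x p k x = 1) ->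
  \sum_(g : {ffun I -> T}) (\prod_j p j (g j)) * f (g k) = \sum_x p k x * f x.
Proof.
move=> p1; pose F j x := p j x * (if j == k then f x else 1).
rewrite (_ : \sum_(g : {ffun I -> T}) _ = \sum_(g : {ffun I -> T}) \prod_j F j (g j)).
  rewrite -(bigA_distr_bigA F) (bigD1 k) //= [X in _ * X]big1 ?mulr1.
    by rewrite /F eqxx.
  move=> j /negbTE jk; rewrite -[RHS](p1 j).
  by apply: eq_bigr => x _; rewrite /F jk mulr1.
apply: eq_bigr => g _; rewrite /F big_split /=; congr (_ * _).
by rewrite (bigD1 k) //= eqxx big1 ?mulr1 // => j /negbTE ->.
Qed.

(** * Spectral calculus and trace inequalities *)

Lemma char_poly_conj (F : comNzRingType) (m : nat) (V' D V : 'M[F]_m) :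
  V' *m V = 1%:M -> char_poly (V' *m D *m V) = char_poly D.
Proof.
move=> VV; rewrite /char_poly.
have -> : char_poly_mx (V' *m D *m V)
    = map_mx polyC V' *m char_poly_mx D *m map_mx polyC V.
  rewrite /char_poly_mx mulmxBr mulmxBl !map_mxM; congr (_ - _).
  rewrite mul_mx_scalar -scalemxAl -map_mxM VV map_scalar_mx /=.
  by rewrite scale_scalar_mx mulr1.
rewrite !det_mulmx mulrAC -det_mulmx -map_mxM VV map_scalar_mx /=.
by rewrite det1 mul1r.
Qed.

Lemma adj_diag_real (R : realType) (m : nat) (v : 'I_m -> R) :
  adj (diag_mx (\row_i ((v i)%:C)%C)) = diag_mx (\row_i ((v i)%:C)%C).
Proof.
rewrite /adj tr_diag_mx map_diag_mx; congr diag_mx.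
apply/rowP => i; rewrite !mxE; apply: conj_Creal.
by apply/complex_realP; exists (v i).
Qed.

Lemma adjM (R : realType) (m n p : nat) (A : 'M[R[i]]_(m, n)) (B : 'M_(n, p)) :
  adj (A *m B) = adj B *m adj A.
Proof. by rewrite /adj trmx_mul map_mxM. Qed.

Lemma adjK (R : realType) (m n : nat) (A : 'M[R[i]]_(m, n)) : adj (adj A) = A.
Proof. by apply/matrixP => i j; rewrite !mxE conjCK. Qed.

Lemma adjB (R : realType) (m n : nat) (A B : 'M[R[i]]_(m, n)) :
  adj (A - B) = adj A - adj B.
Proof. by apply/matrixP => i j; rewrite !mxE rmorphB. Qed.

Lemma hermsymmxP (R : realType) (m : nat) (A : 'M[R[i]]_m) :
  (A \is hermsymmx) <-> adj A = A.
Proof.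
by split=> [/is_hermitianmxP|h]; [|apply/is_hermitianmxP]; rewrite expr0 scale1r.
Qed.

Lemma unitarymxPadj (R : realType) (m : nat) (U : 'M[R[i]]_m) :
  U \is unitarymx -> U *m adj U = 1%:M /\ adj U *m U = 1%:M.
Proof. by move/unitarymxP => h; split=> //; exact: mulmx1C. Qed.

Lemma psd_gram (R : realType) (m n : nat) (M : 'M[R[i]]_(m, n)) :
  psd (adj M *m M).
Proof.
split=> [|v]; first by apply/hermsymmxP; rewrite adjM adjK.
rewrite mulmxA -mulmxA -[v]adjK -adjM adjK mxE sumr_ge0 // => i _.
by rewrite !mxE mulrC mul_conjC_ge0.
Qed.

(** The eigenvalues are real, so taking real parts loses nothing; this links [mxcalc], which acts on
    real parts, to [A] itself. *)
Lemma hermitian_diag (R : realType) (m : nat) (A : 'M[R[i]]_m) :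
    A \is hermsymmx ->
  A = adj (spectralmx A) *m
      diag_mx (\row_i ((reC (eigval A i))%:C)%C) *m spectralmx A.
Proof.
move=> hA; have nA := hermitian_normalmx hA.
have uA := spectral_unitarymx A.
have := orthomx_spectralP nA; rewrite /= (invmx_unitary uA) => {1}->.
congr (_ *m diag_mx _ *m _); apply/rowP => i; rewrite mxE.
have /mxOverP/(_ 0 i) := hermitian_spectral_diag_real hA.
by move/RRe_real => <-.
Qed.

Lemma mxcalcE (R : realType) (m : nat) (f : R -> R) (A : 'M[R[i]]_m) :
  mxcalc f A = adj (spectralmx A) *m
    diag_mx (\row_i ((f (reC (eigval A i)))%:C)%C) *m spectralmx A.
Proof. by rewrite /mxcalc invmx_unitary // spectral_unitarymx. Qed.

Lemma mxcalc_id (R : realType) (m : nat) (A : 'M[R[i]]_m) :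
  A \is hermsymmx -> mxcalc id A = A.
Proof. by move=> hA; rewrite mxcalcE -hermitian_diag. Qed.

Lemma mxcalcB (R : realType) (m : nat) (f g : R -> R) (A : 'M[R[i]]_m) :
  mxcalc (fun x => f x - g x) A = mxcalc f A - mxcalc g A.
Proof.
rewrite !mxcalcE -mulmxBl -mulmxBr -linearB /=; congr (_ *m diag_mx _ *m _).
by apply/rowP => i; rewrite !mxE rmorphB.
Qed.

Lemma mxcalcZ (R : realType) (m : nat) (a : R) (f : R -> R) (A : 'M[R[i]]_m) :
  mxcalc (fun x => a * f x) A = (a%:C)%C *: mxcalc f A.
Proof.
rewrite !mxcalcE scalemxAl scalemxAr -linearZ /=; congr (_ *m diag_mx _ *m _).
by apply/rowP => i; rewrite !mxE rmorphM.
Qed.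

Lemma mxcalc1 (R : realType) (m : nat) (A : 'M[R[i]]_m) :
  mxcalc (fun=> 1) A = 1%:M.
Proof.
rewrite mxcalcE (_ : \row_i _ = const_mx 1) ?diag_const_mx ?mulmx1.
  by case: (unitarymxPadj (spectral_unitarymx A)).
by apply/rowP => i; rewrite !mxE.
Qed.

Lemma mxcalcM (R : realType) (m : nat) (f g : R -> R) (A : 'M[R[i]]_m) :
  mxcalc f A *m mxcalc g A = mxcalc (fun x => f x * g x) A.
Proof.
rewrite !mxcalcE; case: (unitarymxPadj (spectral_unitarymx A)) => u1 _.
rewrite !mulmxA -[_ *m spectralmx A *m _]mulmxA u1 mulmx1.
rewrite -[_ *m diag_mx _ *m diag_mx _]mulmxA mulmx_diag.
congr (_ *m diag_mx _ *m _).
by apply/rowP => i; rewrite !mxE rmorphM.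
Qed.

Lemma mxtrace_mxcalc (R : realType) (m : nat) (f : R -> R) (A : 'M[R[i]]_m) :
  \tr (mxcalc f A) = ((\sum_i f (reC (eigval A i)))%:C)%C.
Proof.
rewrite mxcalcE mxtrace_mulC mulmxA.
case: (unitarymxPadj (spectral_unitarymx A)) => -> _.
rewrite mul1mx mxtrace_diag rmorph_sum /=.
by apply: eq_bigr => i _; rewrite mxE.
Qed.

Lemma eq_mxcalc (R : realType) (m : nat) (f g : R -> R) (A : 'M[R[i]]_m) :
  (forall i, f (reC (eigval A i)) = g (reC (eigval A i))) ->
  mxcalc f A = mxcalc g A.
Proof.
move=> fg; rewrite !mxcalcE; congr (_ *m diag_mx _ *m _).
by apply/rowP => i; rewrite !mxE fg.
Qed.

Lemma mxcalc_hermsymmx (R : realType) (m : nat) (f : R -> R) (A : 'M[R[i]]_m) :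
  mxcalc f A \is hermsymmx.
Proof.
apply/hermsymmxP; rewrite mxcalcE !adjM adjK adj_diag_real.
by rewrite mulmxA.
Qed.

(** The square root of [f] gives a Gram factorisation. Loewner comparisons between functions of one
    matrix thus become scalar inequalities on its spectrum. *)
Lemma psd_mxcalc (R : realType) (m : nat) (f : R -> R) (A : 'M[R[i]]_m) :
  (forall i, 0 <= f (reC (eigval A i))) -> psd (mxcalc f A).
Proof.
move=> f0; pose M := mxcalc (fun x => Num.sqrt (f x)) A.
suff -> : mxcalc f A = adj M *m M by exact: psd_gram.
rewrite (proj1 (hermsymmxP _) (mxcalc_hermsymmx _ _)) mxcalcM.
by apply: eq_mxcalc => i; rewrite -expr2 sqr_sqrtr.
Qed.

Lemma eigval_ge0 (R : realType) (m : nat) (A : 'M[R[i]]_m) (i : 'I_m) :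
  psd A -> 0 <= reC (eigval A i).
Proof.
move=> [hA pA]; case: (unitarymxPadj (spectral_unitarymx A)) => u1 _.
(* The test vector is the [i]-th eigenvector, a row of the spectral matrix. *)
have := pA (delta_mx 0 i *m spectralmx A).
have UK p (B : 'M_(p, m)) : B *m spectralmx A *m adj (spectralmx A) = B.
  by rewrite -mulmxA u1 mulmx1.
rewrite {2}(hermitian_diag hA) adjM !mulmxA !UK.
have -> : adj (delta_mx 0 i) = delta_mx i 0 :> 'cV[R[i]]_m.
  by apply/matrixP => a b; rewrite !mxE andbC rmorph_nat.
by rewrite -rowE -colE !mxE eqxx mulr1n ler0c.
Qed.

Lemma psd_gramP (R : realType) (m : nat) (A : 'M[R[i]]_m) :
  psd A -> A = adj (mxcalc Num.sqrt A) *m mxcalc Num.sqrt A.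
Proof.
move=> pA; rewrite (proj1 (hermsymmxP _) (mxcalc_hermsymmx _ _)) mxcalcM.
rewrite -[LHS](mxcalc_id (proj1 pA)); apply: eq_mxcalc => i.
by rewrite -expr2 sqr_sqrtr // eigval_ge0.
Qed.

(** Writing [A = adj M *m M], cyclicity turns the trace into the sum of the quadratic form of [B]
    over the rows of [M]. *)
Lemma mxtrace_psd_mul_ge0 (R : realType) (m : nat) (A B : 'M[R[i]]_m) :
  psd A -> psd B -> 0 <= \tr (A *m B).
Proof.
move=> pA [hB pB]; rewrite (psd_gramP pA) -mulmxA mxtrace_mulC.
set M := mxcalc _ A; apply: sumr_ge0 => i _.
have := pB (row i M); rewrite -row_mul.
have -> : adj (row i M) = col i (adj M) by apply/matrixP => a b; rewrite !mxE.
by rewrite mxE; congr (0 <= _); rewrite !mxE; apply: eq_bigr => j _; rewrite !mxE.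
Qed.

Lemma ler_mxtrace_mull (R : realType) (m : nat) (A B D : 'M[R[i]]_m) :
  psd D -> loewner_le A B -> \tr (D *m A) <= \tr (D *m B).
Proof.
move=> pD pBA; rewrite -subr_ge0 -linearB /= -mulmxBr.
exact: mxtrace_psd_mul_ge0.
Qed.

Lemma ler_mxtrace_mulr (R : realType) (m : nat) (A B D : 'M[R[i]]_m) :
  psd D -> loewner_le A B -> \tr (A *m D) <= \tr (B *m D).
Proof. by move=> pD pBA; rewrite !(mxtrace_mulC _ D); exact: ler_mxtrace_mull. Qed.

Lemma psd_conj (R : realType) (m n : nat) (A : 'M[R[i]]_m) (M : 'M[R[i]]_(n, m)) :
  psd A -> psd (M *m A *m adj M).
Proof.
move=> [/hermsymmxP hA pA]; split=> [|v].
  by apply/hermsymmxP; rewrite !adjM adjK hA mulmxA.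
by have := pA (v *m M); rewrite adjM !mulmxA.
Qed.

(* [spectral_diag] chooses its own diagonalisation; the characteristic polynomial
   shows that spectral sums can be computed in any unitary eigenbasis. *)
Lemma spectral_sum (R : realType) (m : nat) (V : 'M[R[i]]_m) (v : 'I_m -> R)
    (f : R -> R) :
  V \is unitarymx ->
  let A := adj V *m diag_mx (\row_i ((v i)%:C)%C) *m V in
  \sum_i f (reC (eigval A i)) = \sum_i f (v i).
Proof.
move=> uV A; case: (unitarymxPadj uV) => _ VV.
have hA : A \is hermsymmx.
  by apply/hermsymmxP; rewrite !adjM adjK adj_diag_real mulmxA.
pose s1 := [seq eigval A i | i <- enum 'I_m].
pose s2 := [seq ((v i)%:C)%C | i <- enum 'I_m].
have cpE (d : 'rV[R[i]]_m) :
    char_poly (diag_mx d) = \prod_(x <- [seq d 0 i | i <- enum 'I_m]) ('X - x%:P).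
  rewrite char_poly_trig ?diag_mx_is_trig // big_map big_enum /=.
  by apply: eq_bigr => i _; rewrite !mxE eqxx mulr1n.
(* Both lists are the roots of the same split polynomial, hence agree up to order. *)
have s12 : perm_eq s1 s2.
  apply: prod_XsubC_eq; rewrite -(cpE (spectral_diag A)).
  have -> : s2 = [seq (\row_i ((v i)%:C)%C) 0 i | i <- enum 'I_m].
    by apply: eq_map => i; rewrite mxE.
  rewrite -cpE -(char_poly_conj (diag_mx (\row_i _)) VV) -/A.
  rewrite [in RHS](orthomx_spectralP (hermitian_normalmx hA)).
  by rewrite char_poly_conj // mulVmx // spectral_unit.
transitivity (\sum_(x <- s1) f (reC x)); first by rewrite big_map big_enum.
by rewrite (perm_big _ s12) big_map big_enum.
Qed.

(** Here [adj A *m A] is the square of [A], diagonal in the eigenbasis of [A], so [spectral_sum]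
    evaluates the singular values there. *)
Lemma trnorm_hermitian (R : realType) (m : nat) (A : 'M[R[i]]_m) :
  A \is hermsymmx -> trnorm A = \sum_i `|reC (eigval A i)|.
Proof.
move=> hA; rewrite /trnorm.
have -> : adj A *m A = mxcalc (fun x => x * x) A.
  rewrite (proj1 (hermsymmxP _) hA) -{1 2}(mxcalc_id hA) mxcalcM.
  exact: eq_mxcalc.
rewrite mxcalcE (spectral_sum _ Num.sqrt (spectral_unitarymx A)).
by apply: eq_bigr => i _; rewrite -expr2 sqrtr_sqr.
Qed.

(** For the projector onto the positive eigenspaces of [rho - sigma] the two errors sum to
    [1 - trnorm (rho - sigma) / 2]; both are nonnegative, so each is at most [eps]. *)
Lemma helstrom_projector (R : realType) (m : nat) (rho sigma : 'M[R[i]]_m)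
    (eps : R) :
    density rho -> density sigma -> 1 - trnorm (rho - sigma) / 2 <= eps ->
  exists P : 'M[R[i]]_m, [/\ psd P, psd (1%:M - P), P *m P = P,
    \tr (rho *m (1%:M - P)) <= (eps%:C)%C & \tr (sigma *m P) <= (eps%:C)%C].
Proof.
move=> [pr tr] [ps ts] h; set A := rho - sigma in h.
have hA : A \is hermsymmx.
  apply/hermsymmxP; rewrite /A adjB.
  by case: pr ps => [/hermsymmxP-> _] [/hermsymmxP-> _].
pose f (x : R) : R := if 0 < x then 1 else 0.
pose P := mxcalc f A.
have pP : psd P by apply: psd_mxcalc => i; rewrite /f; case: ifP.
have QE : 1%:M - P = mxcalc (fun x => 1 - f x) A by rewrite mxcalcB mxcalc1.
have pQ : psd (1%:M - P).
  by rewrite QE; apply: psd_mxcalc => i; rewrite /f; case: ifP; rewrite ?subr0 ?subrr.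
have PP : P *m P = P.
  rewrite mxcalcM; apply: eq_mxcalc => i.
  by rewrite /f; case: ifP; rewrite ?mulr1 ?mulr0.
have tAP : \tr (A *m P) = ((trnorm A / 2)%:C)%C.
  rewrite -{1}(mxcalc_id hA) mxcalcM mxtrace_mxcalc trnorm_hermitian //.
  (* The trace vanishes, so adding it to the sum of absolute values changes nothing, and each
     [|x| + x] equals [2 * x * f x]. *)
  have tA : \sum_i reC (eigval A i) = 0.
    apply: (@complexI R); rewrite -(mxtrace_mxcalc id) mxcalc_id //.
    by rewrite /A linearB /= tr ts subrr.
  rewrite (_ : \sum_i `|_| = 2 * \sum_i id (reC (eigval A i)) * f (reC (eigval A i))).
    by rewrite mulrC mulKf // pnatr_eq0.
  transitivity (\sum_i `|reC (eigval A i)| + \sum_i reC (eigval A i)).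
    by rewrite tA addr0.
  rewrite -big_split mulr_sumr; apply: eq_bigr => i _ /=.
  rewrite /f; case: ltP => [x0|x0]; first by rewrite gtr0_norm //; ring.
  by rewrite ler0_norm //; ring.
have key : (1 - \tr (rho *m P)) + \tr (sigma *m P) <= (eps%:C)%C.
  rewrite -addrA (addrC (- _)) -opprB -linearB /= -mulmxBl tAP.
  by rewrite -[1]/((1%:C)%C : R[i]) -rmorphB lecR.
have rQ : \tr (rho *m (1%:M - P)) = 1 - \tr (rho *m P).
  by rewrite mulmxBr mulmx1 linearB /= tr.
exists P; split=> //.
  rewrite rQ; apply: le_trans key; rewrite lerDl.
  exact: mxtrace_psd_mul_ge0.
apply: le_trans key; rewrite lerDr -rQ.
exact: mxtrace_psd_mul_ge0.
Qed.

(** The factor 2 is the price for dropping the off-diagonal blocks of an [A] that may not commute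
    with [P]. *)
Lemma psd_pinching (R : realType) (m : nat) (A P : 'M[R[i]]_m) :
  psd A -> adj P = P -> let Q := 1%:M - P in
  loewner_le A (2 *: (P *m A *m P) + 2 *: (Q *m A *m Q)).
Proof.
move=> pA hP Q.
have hPQ : adj (P - Q) = P - Q.
  rewrite /Q !adjB hP; congr (_ - (_ - _)).
  by rewrite /adj tr_scalar_mx map_scalar_mx rmorph1.
rewrite /loewner_le.
(* The difference is [(P - Q) A (P - Q)], since [A = (P + Q) A (P + Q)]. *)
suff -> : 2 *: (P *m A *m P) + 2 *: (Q *m A *m Q) - A
    = (P - Q) *m A *m adj (P - Q) by exact: psd_conj.
rewrite hPQ; have {3}-> : A = (P + Q) *m A *m (P + Q).
  by rewrite addrC subrK mul1mx mulmx1.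
rewrite !(mulmxDl, mulmxDr, mulmxN, mulNmx).
move: (P *m A *m P) (P *m A *m Q) (Q *m A *m P) (Q *m A *m Q) => a b c e.
by apply/matrixP => i j; rewrite !mxE; ring.
Qed.

Lemma mxtrace_pinching_bound (R : realType) (m : nat)
    (rho1 rho2 sigma Pi P : 'M[R[i]]_m) (a b eta eps : R) :
    0 <= a -> 0 <= b ->
    psd rho1 -> psd rho2 -> psd Pi -> loewner_le Pi 1%:M ->
    psd P -> psd (1%:M - P) -> P *m P = P ->
    loewner_le rho1 ((a%:C)%C *: 1%:M) ->
    loewner_le Pi ((b%:C)%C *: sigma) ->
    \tr rho2 <= (eta%:C)%C ->
    \tr ((rho1 + rho2) *m (1%:M - P)) <= (eps%:C)%C ->
    \tr (sigma *m P) <= (eps%:C)%C ->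
  \tr ((rho1 + rho2) *m Pi) <= ((eta + 2 * (a * b * eps) + 2 * eps)%:C)%C.
Proof.
move=> a0 b0 p1 p2 pPi Pi1 pP pQ PP r1a Pib tr2 trQ trP.
have hP : adj P = P by apply/hermsymmxP; case: pP.
have [Q QE] : exists Q, Q = 1%:M - P by exists (1%:M - P).
rewrite -QE in pQ trQ.
have hQ : adj Q = Q by apply/hermsymmxP; case: pQ.
have QQ : Q *m Q = Q.
  by rewrite {1}QE mulmxBl mul1mx QE mulmxBr mulmx1 PP subrr subr0.
have aC0 : 0 <= (a%:C)%C :> R[i] by rewrite ler0c.
have bC0 : 0 <= (b%:C)%C :> R[i] by rewrite ler0c.
have t2 : \tr (rho2 *m Pi) <= (eta%:C)%C.
  apply: le_trans tr2.
  by have := ler_mxtrace_mull p2 Pi1; rewrite mulmx1.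
(* Bound [Pi] by 1, use cyclicity and [Q *m Q = Q], then add back the nonnegative contribution of
   [rho2]. *)
have tQ : \tr (Q *m rho1 *m Q *m Pi) <= (eps%:C)%C.
  have pQrQ : psd (Q *m rho1 *m Q) by rewrite -{2}hQ; exact: psd_conj.
  have := ler_mxtrace_mull pQrQ Pi1; rewrite mulmx1 => /le_trans; apply.
  rewrite -mulmxA mxtrace_mulC -mulmxA QQ.
  apply: le_trans trQ; rewrite mulmxDl mxtraceD lerDl.
  exact: mxtrace_psd_mul_ge0.
(* Moving the outer [P] onto [Pi] lets [rho1] be replaced by [a] times the identity; then
   [P *m P = P] leaves [\tr (Pi *m P)], and [Pi] is replaced by [b] times [sigma]. *)
have tP : \tr (P *m rho1 *m P *m Pi) <= ((a * b * eps)%:C)%C.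
  have -> : \tr (P *m rho1 *m P *m Pi) = \tr (rho1 *m (P *m Pi *m adj P)).
    by rewrite hP -!mulmxA mxtrace_mulC !mulmxA.
  apply: (le_trans (ler_mxtrace_mulr (psd_conj P pPi) r1a)).
  rewrite hP -scalemxAl mul1mx mxtraceZ -mulrA rmorphM ler_wpM2l //.
  rewrite mxtrace_mulC mulmxA PP mxtrace_mulC.
  apply: (le_trans (ler_mxtrace_mulr pP Pib)).
  by rewrite -scalemxAl mxtraceZ rmorphM ler_wpM2l.
rewrite mulmxDl mxtraceD addrC.
have -> : (eta + 2 * (a * b * eps) + 2 * eps)%:C%C
    = (eta%:C)%C + (2 * ((a * b * eps)%:C)%C + 2 * (eps%:C)%C) :> R[i].
  by rewrite -addrA !rmorphD /= !(rmorphM _ 2) /= rmorph_nat.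
apply: lerD => //; have := ler_mxtrace_mulr pPi (psd_pinching p1 hP).
rewrite -QE => /le_trans; apply.
rewrite mulmxDl mxtraceD -!scalemxAl !mxtraceZ.
by apply: lerD; rewrite ler_wpM2l.
Qed.

(** * Tensor products *)

(** Using positions as the alphabet of [tensW] allows arbitrary factors, such as eigenbases and
    square roots. *)
Definition tensmx {R : realType} {n d : nat} (M : 'I_n -> 'M[R[i]]_d) :
  'M[R[i]]_(tdim n d) := tensW M id.

Lemma big_tdim (V : nmodType) (n d : nat) (F : {ffun 'I_n -> 'I_d} -> V) :
  \sum_(i < tdim n d) F (@enum_val _ (mem {: {ffun 'I_n -> 'I_d}}) i) = \sum_g F g.
Proof. by rewrite [RHS]big_enum_val. Qed.

Lemma tensmxE (R : realType) (n d : nat) (M : 'I_n -> 'M[R[i]]_d) (i j : 'I_(tdim n d)) :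
  tensmx M i j = \prod_k M k (@enum_val _ (mem {: {ffun 'I_n -> 'I_d}}) i k)
                             (@enum_val _ (mem {: {ffun 'I_n -> 'I_d}}) j k).
Proof. by rewrite mxE. Qed.

Lemma tensmxM (R : realType) (n d : nat) (M N : 'I_n -> 'M[R[i]]_d) :
  tensmx M *m tensmx N = tensmx (fun k => M k *m N k).
Proof.
apply/matrixP => i j; rewrite tensmxE [LHS]mxE.
under [LHS]eq_bigr do rewrite !tensmxE -big_split /=.
rewrite (big_tdim (fun g => \prod_k (M k (enum_val i k) (g k) * N k (g k) (enum_val j k)))).
under [RHS]eq_bigr do rewrite mxE.
by rewrite bigA_distr_bigA.
Qed.

Lemma adj_tensmx (R : realType) (n d : nat) (M : 'I_n -> 'M[R[i]]_d) :
  adj (tensmx M) = tensmx (fun k => adj (M k)).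
Proof.
apply/matrixP => i j; rewrite tensmxE !mxE rmorph_prod.
by apply: eq_bigr => k _; rewrite !mxE.
Qed.

Lemma tensmx_diag (R : realType) (n d : nat) (v : 'I_n -> 'I_d -> R) :
  tensmx (fun k => diag_mx (\row_a ((v k a)%:C)%C)) =
  diag_mx (\row_i ((\prod_k v k (@enum_val _ (mem {: {ffun 'I_n -> 'I_d}}) i k))%:C)%C).
Proof.
apply/matrixP => i j; rewrite tensmxE !mxE; have [->|ij] := eqVneq i j.
  by rewrite mulr1n rmorph_prod; apply: eq_bigr => k _; rewrite !mxE eqxx.
have [k kij] : exists k, enum_val i k != enum_val j k.
  apply/existsP; apply: contraNT ij => /existsPn h.
  apply/eqP/enum_val_inj/ffunP => k; apply/eqP.
  by have := h k; rewrite negbK.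
by rewrite mulr0n (bigD1 k) //= !mxE (negbTE kij) mulr0n mul0r.
Qed.

Lemma tensmx1 (R : realType) (n d : nat) :
  tensmx (fun=> 1%:M) = 1%:M :> 'M[R[i]]_(tdim n d).
Proof.
have e m : 1%:M = diag_mx (\row_a ((1 : R)%:C)%C) :> 'M[R[i]]_m.
  by rewrite -diag_const_mx; congr diag_mx; apply/rowP => a; rewrite !mxE.
rewrite !e tensmx_diag; congr diag_mx; apply/rowP => a; rewrite !mxE.
by rewrite big1.
Qed.

Lemma density_tensW (R : realType) (X : Type) (d n : nat) (W : X -> 'M[R[i]]_d)
    (x : 'I_n -> X) :
  (forall x, density (W x)) -> density (tensW W x).
Proof.
move=> HW; split.
  pose G k := mxcalc Num.sqrt (W (x k)).
  suff -> : tensW W x = adj (tensmx G) *m tensmx G by exact: psd_gram.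
  rewrite adj_tensmx tensmxM; apply/matrixP => i j; rewrite tensmxE mxE.
  by apply: eq_bigr => k _; rewrite -psd_gramP //; case: (HW (x k)).
rewrite /mxtrace; under eq_bigr do rewrite mxE.
rewrite (big_tdim (fun g : {ffun 'I_n -> 'I_d} => \prod_k W (x k) (g k) (g k))).
rewrite -(bigA_distr_bigA (fun k a => W (x k) a a)) big1 // => k _.
by case: (HW (x k)).
Qed.

(** The tensor product of the single-letter eigenbases is a unitary eigenbasis, with the products of
    eigenvalues along words as spectrum. *)
Lemma spectral_sum_tensW (R : realType) (X : Type) (d n : nat)
    (W : X -> 'M[R[i]]_d) (x : 'I_n -> X) (f : R -> R) :
    (forall x, W x \is hermsymmx) ->
  \sum_i f (reC (eigval (tensW W x) i)) =
  \sum_(g : {ffun 'I_n -> 'I_d}) f (\prod_k reC (eigval (W (x k)) (g k))).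
Proof.
move=> hW; pose U := tensmx (fun k => spectralmx (W (x k))).
have uU : U \is unitarymx.
  apply/unitarymxP; suff : U *m adj U = 1%:M by [].
  rewrite adj_tensmx tensmxM -[RHS]tensmx1.
  apply/matrixP => i j; rewrite !tensmxE; apply: eq_bigr => k _.
  by case: (unitarymxPadj (spectral_unitarymx (W (x k)))) => ->.
have -> : tensW W x = adj U *m diag_mx (\row_i ((\prod_k reC (eigval (W (x k))
    (@enum_val _ (mem {: {ffun 'I_n -> 'I_d}}) i k)))%:C)%C) *m U.
  rewrite -(tensmx_diag (fun k a => reC (eigval (W (x k)) a))).
  rewrite adj_tensmx !tensmxM; apply/matrixP => i j; rewrite tensmxE mxE.
  by apply: eq_bigr => k _; rewrite -hermitian_diag.
rewrite (spectral_sum _ f uU).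
exact: (big_tdim (fun g : {ffun 'I_n -> 'I_d} =>
  f (\prod_k reC (eigval (W (x k)) (g k))))).
Qed.

(** * Entropy and typicality *)

Lemma ln_prod_pos (R : realType) (I : finType) (F : I -> R) :
  (forall k, 0 < F k) -> ln (\prod_k F k) = \sum_k ln (F k).
Proof.
move=> F0; rewrite -[RHS]expRK expR_sum; congr ln.
by apply: eq_bigr => k _; rewrite lnK // posrE.
Qed.

Lemma ln2_gt0 (R : realType) : 0 < ln 2 :> R.
Proof. by rewrite ln_gt0 // ltr1n. Qed.

Lemma ln2_le1 (R : realType) : ln 2 <= 1 :> R.
Proof. by have := @le_ln1Dx R 1; apply; lra. Qed.

Lemma ln3_ge1 (R : realType) : 1 <= ln 3 :> R.
Proof.
rewrite -[leLHS]expRK ler_ln ?posrE ?expR_gt0 //.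
(* At [h = expR (1 / 2)] the quadratic bound reads [h <= 3/2 + h/8], so [h <= 12/7], and
   [144/49 < 3]. *)
have -> : expR 1 = expR (1 / 2) ^+ 2 :> R by rewrite -expRM_natl; congr expR; field.
have := expR_le_quad (1 / 2 : R); rewrite ger0_norm ?divr_ge0 // => h.
apply: (@le_trans _ _ ((12 / 7) ^+ 2)); last by lra.
by rewrite lerXn2r ?nnegrE ?expR_ge0 //; lra.
Qed.

Lemma exp2D (R : realType) (x y : R) : exp2 (x + y) = exp2 x * exp2 y.
Proof. by rewrite /exp2 mulrDl expRD. Qed.

Lemma ler_exp2 (R : realType) (x y : R) : x <= y -> exp2 x <= exp2 y.
Proof. by move=> xy; rewrite /exp2 ler_expR ler_wpM2r // ltW // ln2_gt0. Qed.

Lemma exp2_ge0 (R : realType) (x : R) : 0 <= exp2 x.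
Proof. exact: expR_ge0. Qed.

Lemma exp2_1 (R : realType) : exp2 1 = 2 :> R.
Proof. by rewrite /exp2 mul1r lnK // posrE. Qed.

Lemma log2K (R : realType) (x : R) : 0 < x -> exp2 (log2 x) = x.
Proof. by move=> x0; rewrite /exp2 /log2 divfK ?lnK // gt_eqF // ln2_gt0. Qed.

Lemma ln_log2 (R : realType) (x : R) : ln x = log2 x * ln 2.
Proof. by rewrite /log2 divfK // gt_eqF // ln2_gt0. Qed.

Lemma entropy_nats (R : realType) (m : nat) (A : 'M[R[i]]_m) :
  psd A ->
  entropy A * ln 2 = \sum_i reC (eigval A i) * - ln (reC (eigval A i)).
Proof.
move=> pA; rewrite /entropy mulNr mulr_suml -sumrN; apply: eq_bigr => i _.
rewrite /xlogx; have := eigval_ge0 i pA; rewrite le_eqVlt => /predU1P[<-|->].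
  by rewrite ltxx /= !mul0r oppr0.
by rewrite [in RHS]ln_log2 mulrN [in RHS]mulrA.
Qed.

Lemma sum_eigval_density (R : realType) (m : nat) (A : 'M[R[i]]_m) :
  density A -> \sum_i reC (eigval A i) = 1.
Proof.
move=> [[hA _] tA]; apply: (@complexI R).
by rewrite -(mxtrace_mxcalc id) mxcalc_id.
Qed.

Lemma entropy_ge0 (R : realType) (m : nat) (A : 'M[R[i]]_m) :
  density A -> 0 <= entropy A.
Proof.
move=> dA; have ev0 i := eigval_ge0 i (proj1 dA).
rewrite -(pmulr_lge0 _ (ln2_gt0 R)) entropy_nats; last by case: dA.
apply: sumr_ge0 => i _; rewrite mulr_ge0 // oppr_ge0 ln_le0 //.
exact: (le1_of_sum1 i ev0 (sum_eigval_density dA)).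
Qed.

Lemma entropy_tens_le (R : realType) (n d : nat) (A : 'M[R[i]]_(tdim n d)) :
  (0 < d)%N -> density A -> entropy A <= n%:R * log2 d%:R.
Proof.
move=> d0 dA; rewrite -(ler_pM2r (ln2_gt0 R)) entropy_nats; last by case: dA.
have ev0 i := eigval_ge0 i (proj1 dA).
apply: (le_trans (gibbs_ln_card ev0 (sum_eigval_density dA))).
rewrite card_ord /tdim card_ffun !card_ord natrX lnXn ?ltr0n //.
by rewrite -mulrA -ln_log2 mulr_natl.
Qed.

(** The fullest of [M] bins of width one holds at least the average number of indices. *)
Lemma pigeonhole_unit_bins (R : realType) (N M : nat) (s : 'I_N -> R) :
    (0 < M)%N -> (forall j, 0 <= s j <= M%:R) ->
  exists C : {set 'I_N}, N%:R / M%:R <= #|C|%:R :> R /\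
    (forall j k, j \in C -> k \in C -> s j - s k <= 1).
Proof.
case: M => // M _ sM.
(* Truncating at the last bin accounts for [s j = M]. *)
pose bin j : 'I_M.+1 := inord (minn (Num.truncn (s j)) M).
have binP j : (bin j)%:R <= s j <= (bin j).+1%:R.
  have /andP[s0 s1] := sM j.
  have /andP[t0 t1] := truncn_itv s0.
  rewrite inordK ?ltnS ?geq_minr //; apply/andP; split.
    by apply: le_trans t0; rewrite ler_nat geq_minl.
  by case: (leqP (Num.truncn (s j)) M) => // _; exact: ltW.
pose C c := [set j | bin j == c].
pose c0 := [arg max_(c > ord0) #|C c|]%N.
exists (C c0); split; last first.
  move=> j k; rewrite !inE => /eqP bj /eqP bk.
  have := binP j; have := binP k; rewrite bj bk => /andP[h1 _] /andP[_ h2].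
  by move: h1 h2; rewrite -natr1; lra.
rewrite ler_pdivrMr ?ltr0n // -natrM ler_nat.
have NE : N = (\sum_c #|C c|)%N.
  rewrite -[LHS]card_ord -sum1_card (partition_big bin predT) //=.
  by apply: eq_bigr => c _; rewrite sum1dep_card.
rewrite {1}NE; apply: (@leq_trans (\sum_(c : 'I_M.+1) #|C c0|)%N).
  by apply: leq_sum => c _; rewrite /c0; case: arg_maxnP => // c' _; apply.
by rewrite sum_nat_const card_ord mulnC.
Qed.

(** The indicator inside [typproj] with the centre and half-width of the window abstracted; the two
    agree by conversion. *)
Definition typical {R : realType} (S D x : R) : R :=
  if (0 < x) && (S - D <= - log2 x <= S + D) then 1 else 0.

Lemma typical_ge0 (R : realType) (S D x : R) : 0 <= typical S D x.
Proof. by rewrite /typical; case: ifP. Qed.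

Lemma typical_le1 (R : realType) (S D x : R) : typical S D x <= 1.
Proof. by rewrite /typical; case: ifP. Qed.

Lemma typical_le (R : realType) (S D x : R) :
  0 <= x -> x * typical S D x <= exp2 (D - S).
Proof.
move=> x0; rewrite /typical; case: ifP => [/andP[xp /andP[h _]]|_].
  by rewrite mulr1 -[leLHS]log2K //; apply: ler_exp2; lra.
by rewrite mulr0 exp2_ge0.
Qed.

Lemma typical_ge (R : realType) (S D x : R) :
  0 <= x -> typical S D x <= exp2 (S + D) * x.
Proof.
move=> x0; rewrite /typical; case: ifP => [/andP[xp /andP[_ h]]|_].
  rewrite -[in leRHS](log2K xp) -exp2D -[leLHS]expR0 ler_expR.
  by rewrite mulr_ge0 ?(ltW (ln2_gt0 R)) //; lra.
by rewrite mulr_ge0 // exp2_ge0.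
Qed.

(** The spectrum of the tensor product is a product distribution on words, so the sum is the
    probability that the information content of a random word leaves the window. *)
Lemma atypical_weight (R : realType) (X : Type) (d n : nat)
    (W : X -> 'M[R[i]]_d) (x : 'I_n -> X) (delta : R) :
    (forall x, density (W x)) -> (1 < d)%N -> (1 <= n)%N -> 0 < delta ->
    delta <= Num.sqrt n%:R * log2 d%:R ->
  \sum_i reC (eigval (tensW W x) i) * (1 - typical (entropy (tensW W x))
      (delta * Num.sqrt n%:R) (reC (eigval (tensW W x) i)))
    <= 2 * exp2 (- (delta ^+ 2 / (36 * @Kfun R d))).
Proof.
move=> HW d1 n1 delta0 delta1; set A := tensW W x.
have dA : density A by exact: density_tensW.
have hW y : W y \is hermsymmx by case: (HW y) => -[].
set D := delta * Num.sqrt n%:R.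
pose p k a := reC (eigval (W (x k)) a).
have p0 k a : 0 <= p k a by apply: eigval_ge0; case: (HW (x k)).
have p1 k : \sum_a p k a = 1 by exact: sum_eigval_density.
pose P (g : {ffun 'I_n -> 'I_d}) := \prod_k p k (g k).
have P0 g : 0 <= P g by apply: prodr_ge0.
have Ppos g : 0 < P g -> forall k, 0 < p k (g k).
  move=> Pg k; rewrite lt_neqAle p0 andbT eq_sym; apply: contraTneq Pg => pk.
  by rewrite /P (bigD1 k) //= pk mul0r ltxx.
have SE : entropy A * ln 2 = \sum_k \sum_a p k a * - ln (p k a).
  rewrite entropy_nats; last by case: dA.
  rewrite (spectral_sum_tensW x (fun y => y * - ln y)) //.
  transitivity (\sum_(g : {ffun 'I_n -> 'I_d}) \sum_k P g * - ln (p k (g k))).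
    apply: eq_bigr => g _; rewrite -mulr_sumr sumrN -/(P g).
    have := P0 g; rewrite le_eqVlt => /predU1P[<-|Pg]; first by rewrite !mul0r.
    by rewrite {2}/P ln_prod_pos //; exact: Ppos.
  rewrite exchange_big /=; apply: eq_bigr => k _.
  exact: (sum_prod_marginal k (fun a => - ln (p k a)) p1).
rewrite (spectral_sum_tensW x (fun y => y * (1 - typical (entropy A) D y))) //.
have ln20 := ln2_gt0 R; have ln21 := ln2_le1 R.
(* [Kfun d] is [(L / ln 2) ^+ 2]; the maximum with 3 ensures [1 <= L]. *)
pose L : R := ln (maxn d 3)%:R.
have L1 : 1 <= L.
  apply: le_trans (ln3_ge1 R) _.
  by rewrite ler_ln ?posrE ?ltr0n ?ler_nat ?leq_max // orbT.
have dL : #|'I_d|%:R <= expR L.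
  rewrite card_ord /L lnK ?ler_nat ?leq_maxl // posrE ltr0n.
  by rewrite leq_max orbT.
have n0 : 0 < n%:R :> R by rewrite ltr0n.
have sn : Num.sqrt n%:R * Num.sqrt n%:R = n%:R :> R.
  by rewrite -expr2 sqr_sqrtr // ltW.
have s0 : 0 < Num.sqrt n%:R :> R by rewrite sqrtr_gt0.
have a0 : 0 <= D * ln 2 by rewrite !mulr_ge0 // ltW.
have aL : D * ln 2 <= #|'I_n|%:R * L.
  rewrite card_ord; apply: (@le_trans _ _ (n%:R * ln d%:R)).
    have h := ler_wpM2r (ltW (mulr_gt0 s0 ln20)) delta1.
    rewrite (ln_log2 d%:R) -[n%:R in leRHS]sn /D.
    by lra.
  rewrite ler_pM2l // ler_ln ?posrE ?ltr0n ?ler_nat ?leq_maxl //.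
    by rewrite ltnW.
  by rewrite leq_max orbT.
have := @information_concentration R 'I_n 'I_d p L (D * ln 2) p0 p1 L1 dL.
rewrite card_ord => /(_ n1 a0); rewrite -{1}(card_ord n) => /(_ aL) conc.
(* Termwise comparison: words of probability zero contribute nothing, and any other word outside the
   window deviates by at least [D * ln 2] in nats. *)
apply: le_trans (le_trans _ conc) _.
  rewrite [leRHS]big_mkcond; apply: ler_sum => g _; rewrite -/(P g) /typical.
  have := P0 g; rewrite le_eqVlt => /predU1P[<-|Pg]; first by rewrite mul0r; case: ifP.
  rewrite Pg /=; case: ifP => [_|]; first by rewrite subrr mulr0; case: ifP.
  move=> out; rewrite subr0 mulr1.
  rewrite sumrB sumrN -ln_prod_pos; last exact: Ppos.
  rewrite -/(P g) -SE (ln_log2 (P g)).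
  have -> : - (log2 (P g) * ln 2) - entropy A * ln 2
      = (- log2 (P g) - entropy A) * ln 2 by ring.
  rewrite normrM (gtr0_norm ln20) ler_pM2r //.
  case: ifP => // /negbT; rewrite -ltNge ltr_norml => /andP[h1 h2].
  by suff : false by []; rewrite -out; apply/andP; split; lra.
rewrite ler_pM2l // /exp2 ler_expR mulNr lerN2 /Kfun /log2 -/L.
have -> : (D * ln 2) ^+ 2 / (36 * L ^+ 2 * n%:R) = delta ^+ 2 * ln 2 ^+ 2 / (36 * L ^+ 2).
  rewrite /D; move: s0 sn; set r := Num.sqrt _ => s0 <-; field.
  by rewrite !gt_eqF //; lra.
have -> : delta ^+ 2 / (36 * (L / ln 2) ^+ 2) * ln 2
    = delta ^+ 2 * ln 2 ^+ 2 / (36 * L ^+ 2) * ln 2.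
  by field; rewrite !gt_eqF //; lra.
(* The nat-based exponent exceeds the required one by a factor [1 / ln 2], so [ln 2 <= 1]
   concludes. *)
rewrite ler_piMr //.
by apply: divr_ge0; apply: mulr_ge0; rewrite ?sqr_ge0.
Qed.

Lemma typproj_mxcalc (R : realType) (X : Type) (d n : nat)
    (W : X -> 'M[R[i]]_d) (delta : R) (x : 'I_n -> X) :
  typproj W delta x =
  mxcalc (typical (entropy (tensW W x)) (delta * Num.sqrt n%:R)) (tensW W x).
Proof. by []. Qed.

Lemma typproj_psd (R : realType) (X : Type) (d n : nat)
    (W : X -> 'M[R[i]]_d) (delta : R) (x : 'I_n -> X) :
  psd (typproj W delta x).
Proof. by apply: psd_mxcalc => i; exact: typical_ge0. Qed.

Lemma typproj_le1 (R : realType) (X : Type) (d n : nat)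
    (W : X -> 'M[R[i]]_d) (delta : R) (x : 'I_n -> X) :
  loewner_le (typproj W delta x) 1%:M.
Proof.
rewrite typproj_mxcalc /loewner_le -(mxcalc1 (tensW W x)) -mxcalcB.
by apply: psd_mxcalc => i; rewrite subr_ge0 typical_le1.
Qed.

Lemma typproj_le_scaled (R : realType) (X : Type) (d n : nat)
    (W : X -> 'M[R[i]]_d) (delta : R) (x : 'I_n -> X) :
  psd (tensW W x) ->
  loewner_le (typproj W delta x)
    ((exp2 (entropy (tensW W x) + delta * Num.sqrt n%:R))%:C%C *: tensW W x).
Proof.
move=> pA; rewrite typproj_mxcalc /loewner_le.
rewrite -{2}(mxcalc_id (proj1 pA)) -mxcalcZ -mxcalcB.
apply: psd_mxcalc => i; rewrite subr_ge0; apply: typical_ge.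
exact: eigval_ge0.
Qed.

Lemma typproj_detects (R : realType) (X : Type) (d n : nat)
    (W : X -> 'M[R[i]]_d) (delta : R) (x : 'I_n -> X) :
    (forall x, density (W x)) -> (1 < d)%N -> (1 <= n)%N -> 0 < delta ->
    delta <= Num.sqrt n%:R * log2 d%:R ->
  ((1 - 2 * exp2 (- (delta ^+ 2 / (36 * @Kfun R d))))%:C)%C
    <= \tr (tensW W x *m typproj W delta x).
Proof.
move=> HW d1 n1 delta0 delta1.
have dA := density_tensW x HW.
rewrite typproj_mxcalc -{1}(mxcalc_id (proj1 (proj1 dA))) mxcalcM mxtrace_mxcalc.
rewrite lecR; have := atypical_weight x HW d1 n1 delta0 delta1.
under eq_bigr do rewrite mulrBr mulr1.
by rewrite sumrB sum_eigval_density //; lra.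
Qed.

Lemma typproj_crosstalk (R : realType) (X : Type) (d n : nat)
    (W : X -> 'M[R[i]]_d) (delta : R) (x y : 'I_n -> X) :
    (forall x, density (W x)) -> (1 < d)%N -> (1 <= n)%N -> 0 < delta ->
    delta <= Num.sqrt n%:R * log2 d%:R ->
    1 - trnorm (tensW W x - tensW W y) / 2
      <= exp2 (- (3 * delta * Num.sqrt n%:R)) ->
    entropy (tensW W y) - entropy (tensW W x) <= 1 ->
  \tr (tensW W x *m typproj W delta y) <=
  ((2 * exp2 (- (delta ^+ 2 / (36 * @Kfun R d)))
    + 6 * exp2 (- (delta * Num.sqrt n%:R)))%:C)%C.
Proof.
move=> HW d1 n1 delta0 delta1 hxy hS.
have dA := density_tensW x HW; have dB := density_tensW y HW.
have [P [pP pQ PP tQ tP]] := helstrom_projector dA dB hxy.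
set A := tensW W x in dA hxy hS tQ *; set B := tensW W y in dB hxy hS tP *.
set D := delta * Num.sqrt n%:R; set eta := 2 * exp2 _.
have pA : psd A by case: dA.
have ev0 i := eigval_ge0 i pA.
set f := typical (entropy A) D.
pose A1 := mxcalc (fun z => z * f z) A.
pose A2 := mxcalc (fun z => z * (1 - f z)) A.
have AE : A = A1 + A2.
  rewrite -[LHS](mxcalc_id (proj1 pA)); apply/eqP; rewrite addrC -subr_eq.
  rewrite -mxcalcB; apply/eqP; apply: eq_mxcalc => i /=.
  by rewrite mulrBr mulr1.
have pA1 : psd A1.
  by apply: psd_mxcalc => i; rewrite mulr_ge0 // typical_ge0.
have pA2 : psd A2.
  by apply: psd_mxcalc => i; rewrite mulr_ge0 // subr_ge0 typical_le1.
have A1le : loewner_le A1 ((exp2 (D - entropy A))%:C%C *: 1%:M).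
  rewrite /loewner_le -(mxcalc1 A) -mxcalcZ -mxcalcB.
  apply: psd_mxcalc => i; rewrite subr_ge0 mulr1; exact: typical_le.
have tA2 : \tr A2 <= (eta%:C)%C.
  by rewrite mxtrace_mxcalc lecR; exact: atypical_weight.
rewrite AE in tQ *.
have := mxtrace_pinching_bound (exp2_ge0 (D - entropy A)) (exp2_ge0 (entropy B + D))
  pA1 pA2 (typproj_psd W delta y) (typproj_le1 W delta y) pP pQ PP A1le
  (typproj_le_scaled delta (proj1 dB)) tA2 tQ tP.
move/le_trans; apply; rewrite lecR -addrA lerD2l.
rewrite -!exp2D -mulrA -/D.
(* Of the exponent [- 3 * D], the two windows consume [2 * D], and the entropy gap costs a factor 2.
   Pinching doubles both terms, so the constant is [2 * 2 + 2 = 6]. *)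
have h1 : exp2 (D - entropy A + (entropy B + D) + - (3 * D)) <= 2 * exp2 (- D).
  by rewrite -exp2_1 -exp2D; apply: ler_exp2; lra.
have h2 : exp2 (- (3 * D)) <= exp2 (- D).
  apply: ler_exp2; have : 0 <= D by rewrite mulr_ge0 ?sqrtr_ge0 // ltW.
  by lra.
by lra.
Qed.

Theorem theorem2 (R : realType) (X : Type) (d : nat)
  (W : X -> 'M[R[i]]_d) (HW : forall x, density (W x))
  (n : nat) (hn : (1 <= n)%N) (delta : R)
  (hdelta0 : 0 < delta) (hdelta1 : delta <= Num.sqrt n%:R * log2 d%:R)
  (N : nat) (u : 'I_N -> 'I_n -> X)
  (hu : forall j k : 'I_N, j != k ->
     1 - trnorm (tensW W (u j) - tensW W (u k)) / 2
       <= exp2 (- (3 * delta * Num.sqrt n%:R))) :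
  exists Cset : {set 'I_N},
    N%:R / (Num.ceil (n%:R * @log2 R d%:R))%:~R <= (#|Cset|%:R : R) /\
    (let eta := 2 * exp2 (- (delta ^+ 2 / (36 * @Kfun R d))) in
     DI_code W Cset u (fun j => typproj W delta (u j))
       eta (eta + 6 * exp2 (- (delta * Num.sqrt n%:R)))).
Proof.
have sn0 : 0 < Num.sqrt n%:R :> R by rewrite sqrtr_gt0 ltr0n.
have ld0 : 0 < @log2 R d%:R.
  by rewrite -(pmulr_rgt0 _ sn0); exact: lt_le_trans hdelta1.
(* The bounds on [delta] force [log2 d] to be positive; [ln_le0] rules out [d = 0] as well as
   [d = 1]. *)
have d1 : (1 < d)%N.
  rewrite ltnNge; apply: contraTN ld0 => d1.
  rewrite -leNgt /log2 pmulr_lle0 ?invr_gt0 ?ln2_gt0 //.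
  by rewrite ln_le0 // -[1]/(1%:R) ler_nat.
have nld0 : 0 < n%:R * @log2 R d%:R by rewrite mulr_gt0 // ltr0n.
pose M := `|Num.ceil (n%:R * @log2 R d%:R)|%N.
have ME : (Num.ceil (n%:R * @log2 R d%:R))%:~R = M%:R :> R.
  by rewrite /M natr_absz gtr0_norm // ceil_gt0.
have M0 : (0 < M)%N by rewrite /M absz_gt0 gt_eqF // ceil_gt0.
(* Rounding [n * log2 d] up gives a whole number of unit bins covering all entropies. *)
have [|C [cardC entC]] := pigeonhole_unit_bins (s := fun j => entropy (tensW W (u j))) M0.
  move=> j; have dj := density_tensW (u j) HW.
  rewrite entropy_ge0 //= -ME; apply: le_trans (ceil_ge _).
  by apply: entropy_tens_le; rewrite // ltnW.
exists C; split; first by rewrite ME.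
move=> eta; split; [|split].
- move=> j _; split; last exact: typproj_le1.
  by rewrite /loewner_le subr0; exact: typproj_psd.
- by move=> j _; exact: typproj_detects.
- move=> j k jC kC jk; apply: typproj_crosstalk => //; first exact: hu.
  exact: entC.
Qed.
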